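(* Let $R$ be any ring. Every $\aleph_1$-generated strongly Gorenstein projective left $R$-module is Gorenstein flat.
   Context: Rings are associative with identity; modules are left modules unless stated otherwise. A module is $\aleph_1$-generated if it can be generated by at most $\aleph_1$ elements. An exact sequence $\cdots\to P^{-1}\to P^0\to P^1\to\cdots$ of projective $R$-modules is a complete projective resolution if $\operatorname{Hom}_R(-,P)$ leaves it exact for every projective $R$-module $P$. An exact sequence $\cdots\to F^{-1}\to F^0\to F^1\to\cdots$ of flat $R$-modules is a complete flat resolution if $E\otimes_R-$ leaves it exact for every injective right $R$-module $E$. A module $M$ is Gorenstein flat if $M\cong\ker(F^0\to F^1)$ for some complete flat resolution. A module $M$ is strongly Gorenstein projective if there is a complete projective resolution of the form $\cdots\to P\xrightarrow{f}P\xrightarrow{f}P\to\cdots$ (the same module $P$ and the same map $f$ in every degree) with $M\cong\ker f$. *)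

(* Defs.v *)
From HB Require Import structures.
From mathcomp Require Import all_boot all_order all_algebra.
From mathcomp Require Import boolp classical_sets functions cardinality.
From mathcomp.multinomials Require Import freeg.

Set Implicit Arguments.
Unset Strict Implicit.
Unset Printing Implicit Defensive.

Import GRing.Theory.
Local Open Scope ring_scope.

(* Rings are [pzRingType]s, so that the zero ring is allowed.  Left modules
   are [lmodType R]; right modules are left modules over the converse ring,
   [lmodType R^c], the right action e.r being [(r : R^c) *: e]. *)

Definition exact_at (A B C : zmodType) (f : A -> B) (g : B -> C) : Prop :=
  forall y, g y = 0 <-> exists x, f x = y.

Section Kernel.
Context (R : pzRingType) (A B : lmodType R) (f : {linear A -> B}).

Definition ker_pred : {pred A} := [pred x | f x == 0].

Fact ker_submod_closed : submod_closed ker_pred.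
Proof.
split=> [|a u v]; rewrite !inE ?linear0 // => /eqP fu /eqP fv.
by rewrite linearP fu fv scaler0 addr0.
Qed.

HB.instance Definition _ :=
  GRing.isSubmodClosed.Build R A ker_pred
    (GRing.submod_closed_semi ker_submod_closed).

Record ker : Type := Ker { ker_val :> A; _ : ker_val \in ker_pred }.

HB.instance Definition _ := [isSub for ker_val].
HB.instance Definition _ := [Choice of ker by <:].
HB.instance Definition _ := [SubChoice_isSubLmodule of ker by <:].

End Kernel.

Definition isomorphic (R : pzRingType) (M N : lmodType R) : Prop :=
  exists h : {linear M -> N}, bijective h.

(* The subgroup of the free abelian group on E * M generated by the
   additivity and balancing relations. *)
Inductive tensor_rel (R : pzRingType) (E : lmodType R^c) (M : lmodType R) :
    {freeg (E * M)} -> Prop :=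
| TensorRel0 : tensor_rel 0
| TensorRelB x y : tensor_rel x -> tensor_rel y -> tensor_rel (x - y)
| TensorRelDl e1 e2 m :
    tensor_rel (<< (e1 + e2, m) >> - << (e1, m) >> - << (e2, m) >>)
| TensorRelDr e m1 m2 :
    tensor_rel (<< (e, m1 + m2) >> - << (e, m1) >> - << (e, m2) >>)
| TensorRelZ (r : R) e m :
    tensor_rel (<< ((r : R^c) *: e, m) >> - << (e, r *: m) >>).

Section Tensor.
Context (R : pzRingType) (E : lmodType R^c) (M : lmodType R).

Definition tensor_pred : {pred {freeg (E * M)}} :=
  [pred x | `[< tensor_rel x >]].

Fact tensor_zmod_closed : zmod_closed tensor_pred.
Proof.
split=> [|x y]; rewrite !inE; first exact: TensorRel0.
by move=> xP yP; apply: TensorRelB.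
Qed.

HB.instance Definition _ :=
  GRing.isZmodClosed.Build {freeg (E * M)} tensor_pred tensor_zmod_closed.

Definition tensor : zmodType := {ideal_quot tensor_pred}.

Definition tensor_pi (x : {freeg (E * M)}) : tensor :=
  (\pi_{ideal_quot tensor_pred} x)%qT.

Definition pure (e : E) (m : M) : tensor := tensor_pi << (e, m) >>.

(* The additive map tensor -> G induced by phi, evaluated on a representative.
   It is well defined, and sends [pure e m] to [phi e m], when phi is balanced:
   see [tensor_lift_pi], [tensor_lift_additive] and [tensor_liftE]. *)
Definition tensor_lift (G : zmodType) (phi : E -> M -> G) (t : tensor) : G :=
  fglift (fun p => phi p.1 p.2 : zmodule G) (repr t).

Definition balanced (G : zmodType) (phi : E -> M -> G) : Prop :=
  [/\ forall e1 e2 m, phi (e1 + e2) m = phi e1 m + phi e2 m,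
      forall e m1 m2, phi e (m1 + m2) = phi e m1 + phi e m2 &
      forall (r : R) e m, phi ((r : R^c) *: e) m = phi e (r *: m)].

Lemma tensor_piB x y : tensor_pi (x - y) = tensor_pi x - tensor_pi y.
Proof. by rewrite /tensor_pi !piE. Qed.

Lemma tensor_pi_eq x y : tensor_pi x = tensor_pi y <-> tensor_rel (x - y).
Proof.
have E1 : (tensor_pi x == tensor_pi y) = `[< tensor_rel (x - y) >].
  by rewrite -[RHS]/(x - y \in tensor_pred) Quotient.idealrBE.
split=> [/eqP|/asboolP xyP]; first by rewrite E1 => /asboolP.
by apply/eqP; rewrite E1.
Qed.

Lemma balanced_pure : balanced pure.
Proof.
have pi0 z : tensor_rel z -> tensor_pi z = 0.
  rewrite -[z in tensor_rel z]subr0 => /tensor_pi_eq->.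
  by rewrite -[X in tensor_pi X](subrr 0) tensor_piB subrr.
split=> [e1 e2 m|e m1 m2|r e m]; last exact/tensor_pi_eq/TensorRelZ.
- apply/eqP; rewrite -subr_eq0 opprD addrA -!tensor_piB.
  exact/eqP/pi0/TensorRelDl.
- apply/eqP; rewrite -subr_eq0 opprD addrA -!tensor_piB.
  exact/eqP/pi0/TensorRelDr.
Qed.

Lemma tensor_ind (P : tensor -> Prop) :
  P 0 -> (forall s t, P s -> P t -> P (s - t)) ->
  (forall e m, P (pure e m)) -> forall t, P t.
Proof.
move=> P0 PB Pp t; rewrite -[t]reprK -[repr t]freeg_sumE.
have PD s u : P s -> P u -> P (s + u).
  by move=> sP uP; rewrite -[u]opprK; apply: (PB) => //; rewrite -sub0r; apply: (PB).
have piD x y : tensor_pi (x + y) = tensor_pi x + tensor_pi y.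
  by rewrite /tensor_pi !piE.
have pi0 : tensor_pi 0 = 0.
  by rewrite -[X in tensor_pi X](subrr 0) tensor_piB subrr.
have PMn s n : P s -> P (s *+ n).
  by move=> sP; elim: n => [|n IHn]; rewrite ?mulr0n // mulrS; apply: (PD).
have PM s (n : int) : P s -> P (s *~ n).
  case: n => n sP; first exact: (PMn).
  by rewrite NegzE mulrNz -sub0r; apply: (PB) => //; apply: (PMn).
have piMn x n : tensor_pi (x *+ n) = tensor_pi x *+ n.
  by elim: n => [|n IHn]; rewrite ?mulr0n // !mulrS piD IHn.
have piMz x (n : int) : tensor_pi (x *~ n) = tensor_pi x *~ n.
  case: n => n; first exact: piMn.
  by rewrite NegzE !mulrNz -sub0r tensor_piB pi0 sub0r piMn.
change (P (tensor_pi (\sum_(z <- dom (repr t)) << coeff z (repr t) *g z >>))).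
elim/big_rec: _ => [|[e m] x _ xP]; first by rewrite pi0.
rewrite piD; apply: (PD) => //.
rewrite -[coeff _ _]intz -freegU_mulz piMz; exact/PM/Pp.
Qed.

Section Lift.
Context (G : zmodType) (phi : E -> M -> G) (phiP : balanced phi).

Let phi' := fun p => phi p.1 p.2 : zmodule G.

Lemma tensor_lift_pi x : tensor_lift phi (tensor_pi x) = fglift phi' x.
Proof.
have relP z : tensor_rel z -> fglift phi' z = 0.
  have [pDl pDr pZ] := phiP; have fB := lift_is_additive phi'.
  elim=> [|x1 x2 _ IH1 _ IH2|e1 e2 m|e m1 m2|r e m].
  - by rewrite -[X in fglift _ X](subrr 0) fB subrr.
  - by rewrite fB IH1 IH2 subrr.
  - rewrite !fB !liftU !scale1r /phi' /= pDl.
    by rewrite -addrA -opprD subrr.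
  - rewrite !fB !liftU !scale1r /phi' /= pDr.
    by rewrite -addrA -opprD subrr.
  - by rewrite !fB !liftU !scale1r /phi' /= pZ subrr.
apply/eqP; rewrite -subr_eq0 /tensor_lift.
have <- := lift_is_additive phi'; apply/eqP/relP/tensor_pi_eq.
exact: reprK.
Qed.

Lemma tensor_lift_additive :
  {morph tensor_lift phi : s t / s - t >-> s - t}.
Proof.
move=> s t; rewrite -[s]reprK -[t]reprK.
change (tensor_lift phi (tensor_pi (repr s) - tensor_pi (repr t)) =
  tensor_lift phi (tensor_pi (repr s)) - tensor_lift phi (tensor_pi (repr t))).
rewrite -tensor_piB !tensor_lift_pi; exact: (lift_is_additive phi').
Qed.

Lemma tensor_liftE e m : tensor_lift phi (pure e m) = phi e m.
Proof. by rewrite tensor_lift_pi liftU scale1r. Qed.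

End Lift.

End Tensor.

(* The map f (x) g. *)
Definition tensor_map (R : pzRingType) (E E' : lmodType R^c) (M M' : lmodType R)
    (f : {linear E -> E'}) (g : {linear M -> M'}) : tensor E M -> tensor E' M' :=
  tensor_lift (fun e m => pure (f e) (g m)).

Section TensorMapTheory.
Context (R : pzRingType) (E E' : lmodType R^c) (M M' : lmodType R).
Context (f : {linear E -> E'}) (g : {linear M -> M'}).

Fact tensor_map_balanced : balanced (fun e m => pure (f e) (g m)).
Proof.
have [pDl pDr pZ] := balanced_pure E' M'.
by split=> *; rewrite ?linearD ?linearZ ?pDl ?pDr ?pZ.
Qed.

Lemma tensor_mapB :
  {morph tensor_map f g : s t / s - t >-> s - t}.
Proof. exact/tensor_lift_additive/tensor_map_balanced. Qed.

Lemma tensor_mapE e m : tensor_map f g (pure e m) = pure (f e) (g m).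
Proof. exact/tensor_liftE/tensor_map_balanced. Qed.

End TensorMapTheory.

Definition projective (R : pzRingType) (P : lmodType R) : Prop :=
  forall (A B : lmodType R) (p : {linear A -> B}) (f : {linear P -> B}),
    (forall b, exists a, p a = b) ->
    exists h : {linear P -> A}, forall x, p (h x) = f x.

Definition injective_module (R : pzRingType) (E : lmodType R) : Prop :=
  forall (A B : lmodType R) (i : {linear A -> B}) (f : {linear A -> E}),
    injective i -> exists h : {linear B -> E}, forall x, h (i x) = f x.

(* - (x) F is an exact functor on right modules. *)
Definition flat (R : pzRingType) (F : lmodType R) : Prop :=
  forall (A B C : lmodType R^c) (f : {linear A -> B}) (g : {linear B -> C}),
    exact_at f g ->
    exact_at (tensor_map f (idfun : {linear F -> F}))
             (tensor_map g (idfun : {linear F -> F})).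

(* As i ranges over the integers, i + 1 does too, so exactness at every
   X (i + 1) is exactness everywhere. *)
Definition exact_seq (R : pzRingType) (X : int -> lmodType R)
    (d : forall i, {linear X i -> X (i + 1)}) : Prop :=
  forall i, exact_at (d i) (d (i + 1)).

(* Exactness of the sequence of the Hom(X i, Q), with maps - \o d i. *)
Definition hom_exact (R : pzRingType) (X : int -> lmodType R)
    (d : forall i, {linear X i -> X (i + 1)}) (Q : lmodType R) : Prop :=
  forall i (u : {linear X (i + 1) -> Q}),
    (forall x, u (d i x) = 0) <->
    exists v : {linear X (i + 1 + 1) -> Q}, forall x, v (d (i + 1) x) = u x.

Definition complete_projective_resolution (R : pzRingType)
    (P : int -> lmodType R) (d : forall i, {linear P i -> P (i + 1)}) : Prop :=
  [/\ forall i, projective (P i), exact_seq d &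
      forall Q : lmodType R, projective Q -> hom_exact d Q].

Definition complete_flat_resolution (R : pzRingType)
    (F : int -> lmodType R) (d : forall i, {linear F i -> F (i + 1)}) : Prop :=
  [/\ forall i, flat (F i), exact_seq d &
      forall E : lmodType R^c, injective_module E ->
        forall i, exact_at (tensor_map (idfun : {linear E -> E}) (d i))
                           (tensor_map (idfun : {linear E -> E}) (d (i + 1)))].

Definition Gorenstein_flat (R : pzRingType) (M : lmodType R) : Prop :=
  exists (F : int -> lmodType R) (d : forall i, {linear F i -> F (i + 1)}),
    complete_flat_resolution d /\ isomorphic M (ker (d 0)).

Definition strongly_Gorenstein_projective (R : pzRingType) (M : lmodType R) :
    Prop :=
  exists (P : lmodType R) (f : {linear P -> P}),
    complete_projective_resolution (P := fun=> P) (fun=> f) /\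
    isomorphic M (ker f).

Local Open Scope card_scope.

(* aleph_1 is the least uncountable cardinal. *)
Definition has_card_aleph1 (T : Type) (A : set T) : Prop :=
  ~ countable A /\
  forall (U : Type) (B : set U), ~ countable B -> A #<= B.

Definition generates (R : pzRingType) (M : lmodType R) (G : set M) : Prop :=
  forall x : M, exists (n : nat) (a : 'I_n -> R) (g : 'I_n -> M),
    (forall i, G (g i)) /\ x = \sum_(i < n) a i *: g i.

Definition aleph1_generated (R : pzRingType) (M : lmodType R) : Prop :=
  exists (T : Type) (A : set T) (G : set M),
    [/\ has_card_aleph1 A, G #<= A & generates G].

(* Main.v *)
Require Import Defs.
From HB Require Import structures.
From mathcomp Require Import all_boot all_order all_algebra.
From mathcomp Require Import boolp classical_sets functions cardinality fsbigop.

(* Let P be projective with f : P -> P as in the definition of a strongly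
   Gorenstein projective module.  For an injective right module E, exactness of
   E (x) P follows by duality from a local statement: for every finite X0 in P
   there is a finite X1 such that every y : P -> R with y f = 0 on X1 agrees on
   X0 with some z f.  If P is countably generated and this fails for X0, pick
   counterexamples y_n for an exhausting sequence of finite sets; (y_n f)_n is
   a map to R^(nat) that kills im f, so it is h f with h : P -> R^(nat), and
   y_n - h_n, which kills im f, is of the form z_n f; as h_n vanishes on X0 for
   large n, y_n is not a counterexample.

   With aleph_1 generators one uses that the order of omega_1 is an increasing
   union of a sequence of tree orders with finite initial segments (this is
   Todorcevic's function rho).  They index counterexamples y_{n,a} by
   nat * omega_1 and cut the family (y_{n,a} f)_a down, at level n, to maps g_n
   into the free module on omega_1 such that g_n f is eventually 0 pointwise.
   Solving for g_n modulo cocycles and looking at a coordinate a outside a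
   countable set brings one back to a sequence (y_{n,a})_n as above. *)

Set Implicit Arguments.
Unset Strict Implicit.
Unset Printing Implicit Defensive.

Import GRing.Theory.
Local Open Scope classical_set_scope.
Local Open Scope ring_scope.

(** * Ladders on countable and uncountable sets *)

(* An increasing sequence of preorders on D, any two elements being comparable
   from some level on, whose initial segments are finite chains. *)
Record ladder_on (T : Type) (D : set T) (r : nat -> T -> T -> Prop) : Prop := {
  ladder_dom : forall n x y, r n x y -> D x /\ D y;
  ladder_refl : forall n x, D x -> r n x x;
  ladder_trans : forall n x y z, r n x y -> r n y z -> r n x z;
  ladder_mono : forall m n x y, (m <= n)%N -> r m x y -> r n x y;
  ladder_fin : forall n y, finite_set [set x | r n x y];
  ladder_total : forall x y, D x -> D y -> exists n, r n x y \/ r n y x;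
  ladder_tree : forall n x y z, r n x z -> r n y z -> r n x y \/ r n y x }.

(** This prepares the addition of a point above all of D: [S n] will be its initial segment at level
    n. Countability gives a cofinal sequence, increasing from suitable levels on, and [S n] is the
    part of D that finitely many of its terms dominate. *)
Lemma ladder_exhaustion (T : Type) (D : set T) (r : nat -> T -> T -> Prop) :
  ladder_on D r -> countable D ->
  exists S : nat -> set T,
  [/\ forall n, finite_set (S n), forall m n, (m <= n)%N -> S m `<=` S n,
      \bigcup_n S n = D, forall n x y, r n x y -> S n y -> S n x &
      forall n x y, S n x -> S n y -> r n x y \/ r n y x].
Proof.
move=> [rD rR rT rM rF rC rL] cD.
have [->|/set0P[d0 Dd0]] := eqVneq D set0.
  by exists (fun=> set0); split=> // [m n _ //|]; apply: bigcup0.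
have [d [dD dS]] : exists d : nat -> T, (forall n, D (d n)) /\
    (forall x, D x -> exists n, d n = x).
  have [e einj] := countable_injP _ cD.
  have /choice[d dP] : forall n, exists x, D x /\
      ((exists2 y, D y & e y = n) -> e x = n).
    move=> n; have [[y Dy eyn]|h] := pselect (exists2 y, D y & e y = n).
      by exists y.
    by exists d0; split=> // /h.
  exists d; split=> [n|x Dx]; first by case: (dP n).
  exists (e x); have [Dd /(_ (ex_intro2 _ _ x Dx erefl))] := dP (e x).
  by apply: einj; rewrite inE.
(* [d] enumerates D; [st k] is a pair (x, N) such that x dominates
   d 0, ..., d k.-1 at level N. *)
have /choice[F FP] : forall q : nat * (T * nat), exists q' : T * nat,
    D q.2.1 -> [/\ D q'.1, (q.2.2 <= q'.2)%N, r q'.2 q.2.1 q'.1 &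
                   r q'.2 (d q.1) q'.1].
  move=> [k [x N]] /=.
  have [Dx|nDx] := pselect (D x); last by exists (x, N).
  have [m [xd|dx]] := rC _ _ Dx (dD k).
    exists (d k, maxn N m); split; rewrite ?leq_maxl //=.
      by apply: rM xd; rewrite leq_maxr.
    exact: rR.
  exists (x, maxn N m); split; rewrite ?leq_maxl //=; first exact: rR.
  by apply: rM dx; rewrite leq_maxr.
pose st := fix st k : T * nat := if k is k'.+1 then F (k', st k') else (d0, 0%N).
have stD k : D (st k).1.
  by elim: k => //= k IHk; have [] := FP (k, st k) IHk.
have stP k : [/\ ((st k).2 <= (st k.+1).2)%N, r (st k.+1).2 (st k).1 (st k.+1).1 &
    r (st k.+1).2 (d k) (st k.+1).1].
  by have [] := FP (k, st k) (stD k).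
have stN k l : (k <= l)%N -> ((st k).2 <= (st l).2)%N.
  elim: l => [|l IHl]; first by rewrite leqn0 => /eqP->.
  rewrite leq_eqVlt => /orP[/eqP->//|/IHl kl].
  by apply: leq_trans kl _; case: (stP l).
have str k l n : (k <= l)%N -> ((st l).2 <= n)%N -> r n (st k).1 (st l).1.
  elim: l => [|l IHl]; first by rewrite leqn0 => /eqP-> _; apply: rR; apply: stD.
  rewrite leq_eqVlt => /orP[/eqP-> _|kl ln]; first by apply: rR; apply: stD.
  have [l1 l2 _] := stP l.
  by apply: rT (IHl kl (leq_trans l1 ln)) (rM _ _ _ _ ln l2).
(* The bound on k makes the union finite; the bound on the level of [st k] makes the points used
   comparable at level n, whence the chain property. *)
exists (fun n => \bigcup_(k in [set k | (k <= n)%N /\ ((st k).2 <= n)%N])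
   [set x | r n x (st k).1]); split.
- move=> n; apply: bigcup_finite => // .
  apply: sub_finite_set (finite_II n.+1) => k /= [kn _].
  by rewrite ltnS.
- move=> m n mn x [k [/= km Nm] xk]; exists k => /=; last exact: rM xk.
  by split; apply: leq_trans mn.
- apply/seteqP; split=> [x [n _ [k _ /= /rD[]]]//|x /dS[k <-]].
  exists (maxn k.+1 (st k.+1).2) => //; exists k.+1 => /=.
    by rewrite leq_maxl leq_maxr.
  by have [_ _] := stP k; apply: rM; rewrite leq_maxr.
- by move=> n x y xy [k kn /= yk]; exists k => //=; apply: rT yk.
- move=> n x y [k [_ kn] /= xk] [l [_ ln] /= yl].
  have [kl|/ltnW lk] := leqP k l.
    exact: rL (rT _ _ _ _ xk (str _ _ _ kl ln)) yl.
  exact: rL xk (rT _ _ _ _ yl (str _ _ _ lk kn)).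
Qed.

(** The new point [a] is placed above the sets of [ladder_exhaustion]: their downward closure gives
    transitivity, their being chains gives the tree property, and their union being D makes [a]
    comparable with every point. Nothing is added below an old point, so that such extensions can be
    glued. *)
Lemma ladder_extend (T : Type) (D : set T) (r : nat -> T -> T -> Prop) (a : T) :
  ladder_on D r -> countable D -> ~ D a ->
  exists r', ladder_on (a |` D) r' /\ forall n x y, D y -> (r' n x y <-> r n x y).
Proof.
move=> rP cD nDa; have [S [SF SM SD Sd SC]] := ladder_exhaustion rP cD.
case: rP => rD rR rT rM rF rC rL.
have SDn n x : S n x -> D x by move=> Snx; rewrite -SD; exists n.
exists (fun n x y => r n x y \/ y = a /\ (x = a \/ S n x)); split; last first.
  move=> n x y Dy; split=> [[//|[ya]]|]; last by left.
  by case: nDa; rewrite -ya.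
split.
- move=> n x y [/rD[Dx Dy]|[-> [->|/SDn Dx]]]; first by split; right.
    by split; left.
  by split; [right|left].
- by move=> n x [->|Dx]; [right; split=> //; left|left; apply: rR].
- move=> n x y z [xy|[-> xa]] [yz|[-> ya]].
  + by left; apply: rT yz.
  + right; split=> //; case: ya => [ya|Sy]; last by right; apply: Sd Sy.
    by case: nDa; rewrite -ya; case: (rD _ _ _ xy).
  + by case: nDa; case: (rD _ _ _ yz).
  + by right.
- move=> m n x y mn [xy|[-> [->|Sx]]]; first by left; apply: rM xy.
    by right; split=> //; left.
  by right; split=> //; right; apply: SM Sx.
- move=> n y; apply: (@sub_finite_set _ _ ([set x | r n x y] `|` (a |` S n))).
    by move=> x /= [xy|[_ [->|Sx]]]; [left|right; left|right; right].
  by rewrite !finite_setU; do !split=> //.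
- have aC y : D y -> exists n, S n y by rewrite -{1}SD => -[n _ Sy]; exists n.
  move=> x y [->|Dx] [->|Dy].
  + by exists 0%N; left; right; split=> //; left.
  + have [n Sy] := aC _ Dy; exists n; right; right; split=> //; by right.
  + have [n Sx] := aC _ Dx; exists n; left; right; split=> //; by right.
  + by have [n [xy|yx]] := rC _ _ Dx Dy; exists n; [left; left|right; left].
- move=> n x y z [xz|[-> xa]] [yz|[ea ya]].
  + by have [|] := rL _ _ _ _ xz yz; [left; left|right; left].
  + by case: nDa; rewrite -ea; case: (rD _ _ _ xz).
  + by case: nDa; case: (rD _ _ _ yz).
  + case: xa => [->|Sx]; first by right; right.
    case: ya => [->|Sy]; first by left; right; split=> //; right.
    by have [|] := SC _ _ _ Sx Sy; [left; left|right; left].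
Qed.

(* Order ladders by end extension: a maximal one is uncountable, since a
   countable one extends by one point. *)
Lemma uncountable_ladder (T : Type) : ~ countable [set: T] ->
  exists (D : set T) r, ladder_on D r /\ ~ countable D.
Proof.
move=> ncT.
pose L := {Dr : set T * (nat -> T -> T -> Prop) | ladder_on Dr.1 Dr.2}.
pose le (u v : L) : bool := `[< (sval u).1 `<=` (sval v).1 /\
  forall n x y, (sval u).1 y -> ((sval v).2 n x y <-> (sval u).2 n x y) >].
have l0 : ladder_on (@set0 T) (fun _ _ _ => False).
  by split=> // n y; rewrite (_ : [set _ | _] = set0) //; apply/seteqP; split.
have [||A Atot|[[D r] /= rP] rmax] := @ZL_preorder L (exist _ (_, _) l0) le.
- by move=> u; apply/asboolP; split.
- move=> u v w /asboolP[uv1 uv2] /asboolP[vw1 vw2]; apply/asboolP; split.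
    exact: subset_trans vw1.
  by move=> n x y uy; rewrite vw2 ?uv2 //; apply: uv1.
- pose DA := \bigcup_(u in A) (sval u).1.
  pose rA n x y := exists2 u, A u & (sval u).2 n x y.
  have tot2 u v : A u -> A v -> exists w, [/\ A w, le u w & le v w].
    have lexx (w : L) : le w w by apply/asboolP; split.
    by move=> Au Av; have [uv|vu] := Atot _ _ Au Av; [exists v|exists u].
  have up u v : le u v -> forall n x y, (sval u).2 n x y -> (sval v).2 n x y.
    move=> /asboolP[uv1 uv2] n x y xy; apply/uv2 => //.
    by have [] := ladder_dom (svalP u) xy.
  (* End extension at work: larger members of the chain add nothing below a point of [u], so initial
     segments stay finite in the union. *)
  have down u n x y : A u -> (sval u).1 y -> rA n x y -> (sval u).2 n x y.
    move=> Au uy [v Av xy]; have [w [Aw /asboolP[_ uw] vw]] := tot2 _ _ Au Av.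
    by apply/uw => //; apply: up vw _ _ _ xy.
  have rAP : ladder_on DA rA.
    split.
    + move=> n x y [u Au /(ladder_dom (svalP u))[ux uy]].
      by split; exists u.
    + by move=> n x [u Au ux]; exists u => //; apply: (ladder_refl (svalP u)).
    + move=> n x y z xy [u Au yz]; exists u => //.
      have [uy uz] := ladder_dom (svalP u) yz.
      exact: (ladder_trans (svalP u) (down _ _ _ _ Au uy xy) yz).
    + move=> m n x y mn [u Au xy]; exists u => //.
      exact: (ladder_mono (svalP u) mn xy).
    + move=> n y; have [[u Au uy]|nDy] := pselect (DA y).
        apply: sub_finite_set (ladder_fin (svalP u) n y) => x /=.
        exact: down.
      rewrite (_ : [set _ | _] = set0) //; apply/seteqP; split=> // x [u Au].
      by move=> /(ladder_dom (svalP u))[_ uy]; apply: nDy; exists u.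
    + move=> x y [u Au ux] [v Av vy].
      have [w [Aw /asboolP[uw _] /asboolP[vw _]]] := tot2 _ _ Au Av.
      have [n [xy|yx]] := ladder_total (svalP w) (uw _ ux) (vw _ vy).
        by exists n; left; exists w.
      by exists n; right; exists w.
    + move=> n x y z xz [u Au yz].
      have [_ uz] := ladder_dom (svalP u) yz.
      have [xy|yx] := ladder_tree (svalP u) (down _ _ _ _ Au uz xz) yz.
        by left; exists u.
      by right; exists u.
  exists (exist _ (_, _) rAP) => u Au; apply/asboolP; split=> /=.
    by move=> x ux; exists u.
  by move=> n x y uy; split=> [|xy]; [apply: down|exists u].
exists D, r; split=> // cD.
have [a nDa] : exists a, ~ D a.
  apply: contrapT => /forallNP DT; apply: ncT.
  apply: sub_countable cD; apply: subset_card_le => x _.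
  exact: contrapT (DT x).
have [r' [r'P r'r]] := ladder_extend rP cD nDa.
have /(_ _)/asboolP[] := rmax (exist _ (_, _) r'P) _.
  by apply/asboolP; split=> //= x; right.
by move=> /= /(_ a) aD _; apply: nDa; apply: aD; left.
Qed.

(** * Free modules *)

Section FreeModule.
Context (R : pzRingType) (I : choiceType).

Definition finsupp_pred : {pred (I -> R^o)} :=
  [pred x : I -> R^o | `[< finite_set [set i | x i <> 0] >]].

Fact finsupp_submod_closed : submod_closed finsupp_pred.
Proof.
split=> [|a u v]; rewrite !inE.
  by rewrite (_ : [set _ | _] = set0) //; apply/seteqP; split=> // i /=; apply.
move=> uF vF.
apply: (@sub_finite_set _ _ ([set i | u i <> 0] `|` [set i | v i <> 0])).
  move=> i /= auv; apply: contrapT => /not_orP[/contrapT u0 /contrapT v0].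
  by apply: auv; rewrite !fctE u0 v0 scaler0 addr0.
by rewrite finite_setU.
Qed.

HB.instance Definition _ :=
  GRing.isSubmodClosed.Build R (I -> R^o) finsupp_pred
    (GRing.submod_closed_semi finsupp_submod_closed).

Record free_module : Type :=
  FreeModule { free_val : I -> R^o; _ : free_val \in finsupp_pred }.

HB.instance Definition _ := [isSub for free_val].
HB.instance Definition _ := [Choice of free_module by <:].
HB.instance Definition _ := [SubChoice_isSubLmodule of free_module by <:].

Definition free_coef (x : free_module) (i : I) : R := free_val x i.
Local Coercion free_coef : free_module >-> Funclass.

Lemma free_finP (x : free_module) : finite_set [set i | x i <> 0].
Proof. by have := valP x; rewrite inE. Qed.

Lemma free_eqP (x y : free_module) : (forall i, x i = y i) -> x = y.
Proof. by move=> xy; apply/val_inj/funext. Qed.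

Lemma free_linE (a : R) (x y : free_module) i : (a *: x + y) i = a * x i + y i.
Proof. by []. Qed.

Fact free_delta_subproof (i : I) :
  (fun j => (j == i)%:R : R^o) \in finsupp_pred.
Proof.
rewrite inE; apply: sub_finite_set (finite_set1 i) => j /=.
by case: eqVneq => //= _ /(_ erefl).
Qed.

Definition free_delta i := FreeModule (free_delta_subproof i).

Context (M : lmodType R).
Implicit Types a : I -> M.

Definition free_lift a (x : free_module) : M := \sum_(i \in [set: I]) x i *: a i.

Lemma free_support (x : free_module) :
  exists2 s : seq I, uniq s & forall i, (i \in s) = (x i != 0).
Proof.
have /finite_seqP[s sE] := free_finP x; exists (undup s) => [|i].
  exact: undup_uniq.
rewrite mem_undup; have := congr1 (fun A : set I => A i) sE => /= E.
by apply/idP/idP => [|/eqP]; [rewrite -E => /eqP|rewrite E].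
Qed.

(** The list may exceed the support, which lets several vectors be summed over one list. *)
Lemma free_liftE (s : seq I) a (x : free_module) : uniq s ->
  (forall i, i \notin s -> x i = 0) -> free_lift a x = \sum_(i <- s) x i *: a i.
Proof.
move=> us xs; rewrite /free_lift (fsbigE s) //.
  by apply: eq_bigl => i; rewrite in_setT.
by move=> i _ /xs->; rewrite scale0r.
Qed.

Fact free_lift_linear a : linear (free_lift a).
Proof.
move=> k x y; have [s _ sP] := free_support x; have [t _ tP] := free_support y.
have us : uniq (undup (s ++ t)) by exact: undup_uniq.
have out i : i \notin undup (s ++ t) -> x i = 0 /\ y i = 0.
  by rewrite mem_undup mem_cat negb_or sP tP !negbK => /andP[/eqP-> /eqP->].
rewrite (@free_liftE _ _ (k *: x + y) us); last first.
  by move=> i /out[x0 y0]; rewrite free_linE x0 y0 mulr0 addr0.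
rewrite (@free_liftE _ _ x us) => [|i /out[]//].
rewrite (@free_liftE _ _ y us) => [|i /out[]//].
rewrite scaler_sumr -big_split; apply: eq_bigr => i _.
by rewrite free_linE scalerDl scalerA.
Qed.

HB.instance Definition _ a :=
  GRing.isLinear.Build R free_module M *:%R (free_lift a) (free_lift_linear a).

Lemma free_lift_delta a i : free_lift a (free_delta i) = a i.
Proof.
rewrite (@free_liftE [:: i]) // => [|j].
  by rewrite big_seq1 /free_coef /= eqxx scale1r.
by rewrite inE /free_coef /= => /negPf->.
Qed.

End FreeModule.
Coercion free_coef : free_module >-> Funclass.

Lemma free_expand (R : pzRingType) (I : choiceType) (x : free_module R I) :
  free_lift (@free_delta R I) x = x.
Proof.
have [s us sP] := free_support x; apply: free_eqP => j.
rewrite (@free_liftE _ _ _ s) // => [|i]; last by rewrite sP negbK => /eqP.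
have coefD (y z : free_module R I) : (y + z) j = y j + z j by [].
rewrite (big_morph (fun y : free_module R I => y j) coefD (erefl _)).
rewrite (eq_bigr (fun i => x i * (j == i)%:R)) //.
have [js|js] := boolP (j \in s).
  rewrite (bigD1_seq j) //= eqxx mulr1 big1 ?addr0 // => i ij.
  by rewrite eq_sym (negPf ij) mulr0.
rewrite big_seq big1 => [|i is_]; first by rewrite sP negbK in js; rewrite (eqP js).
by case: eqVneq => [ji|_]; [rewrite ji is_ in js | rewrite mulr0].
Qed.

Lemma linear_free_lift (R : pzRingType) (I : choiceType) (M N : lmodType R)
    (g : {linear M -> N}) (a : I -> M) (x : free_module R I) :
  g (free_lift a x) = free_lift (g \o a) x.
Proof.
have [s us sP] := free_support x.
have xs i : i \notin s -> x i = 0 by rewrite sP negbK => /eqP.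
rewrite !(free_liftE _ us xs) linear_sum.
by apply: eq_bigr => i _; rewrite linearZ_LR.
Qed.

Lemma free_projective (R : pzRingType) (I : choiceType) :
  projective (free_module R I).
Proof.
move=> A B p f psurj.
have /choice[a aP] : forall i, exists a, p a = f (free_delta R i).
  by move=> i; apply: psurj.
exists (free_lift a) => x.
rewrite -[X in p X]/(free_lift a x) linear_free_lift.
by rewrite -[in RHS](free_expand x) linear_free_lift; congr (free_lift _ _); apply/funext.
Qed.

Definition linear_of (R : pzRingType) (M N : lmodType R) (g : M -> N)
  (gP : linear g) : {linear M -> N} :=
  HB.pack g (GRing.isLinear.Build R M N *:%R g gP).

Lemma regular_projective (R : pzRingType) : projective R^o.
Proof.
move=> A B p f psurj; have [a pa] := psurj (f 1).
have lin : linear (fun x : R^o => (x : R) *: a).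
  by move=> k x y; rewrite scalerDl -scalerA.
exists (linear_of lin) => x /=; rewrite linearZ_LR pa -linearZ_LR.
by congr (f _); rewrite -[_ *: _]/(x * 1) mulr1.
Qed.

Lemma finite_set_nat_bounded (A : set nat) :
  finite_set A -> exists N, forall n, A n -> (n < N)%N.
Proof.
move=> /finite_seqP[s ->]; exists (\max_(i <- s) i).+1 => n ns.
by rewrite ltnS; apply: leq_bigmax_seq.
Qed.

(** * Local factorization of functionals through f *)

Section LocalFactorization.
Context (R : pzRingType) (P : lmodType R) (f : {linear P -> P}).
Hypothesis ff0 : forall x, f (f x) = 0.
Hypothesis factor : forall (Q : lmodType R), projective Q ->
  forall u : {linear P -> Q}, (forall x, u (f x) = 0) ->
  exists v : {linear P -> Q}, forall x, v (f x) = u x.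

(** A pointwise finite family of functionals is one map into a free module. Applying [factor] to
    that map keeps the new family pointwise finite, which separate applications to each member would
    not. *)
Lemma factor_family (I : choiceType) (u : I -> {linear P -> R^o}) :
  (forall x, finite_set [set i | u i x <> 0]) ->
  (forall i x, u i (f x) = 0) ->
  exists v : I -> {linear P -> R^o},
    (forall x, finite_set [set i | v i x <> 0]) /\
    forall i x, v i (f x) = u i x.
Proof.
move=> uF uf.
have uS x : (fun i => u i x) \in @finsupp_pred R I by rewrite inE; apply: uF.
have lin : linear (fun x => FreeModule (uS x)).
  by move=> k x y; apply: free_eqP => i; rewrite free_linE /free_coef /= linearP.
have [|v vP] := factor (@free_projective R I) (u := linear_of lin).
  by move=> x; apply: free_eqP => i; rewrite /free_coef /= uf.
have linv i : linear (fun x => free_coef (v x) i : R^o).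
  by move=> k x y; rewrite linearP free_linE.
exists (fun i => linear_of (linv i)); split=> [x|i x].
  exact: free_finP (v x).
by rewrite /= vP.
Qed.

Context (J : choiceType) (r : nat -> J -> J -> Prop) (p : J -> P).
Context (sigma : {linear P -> free_module R J}).
Hypothesis rP : ladder_on [set: J] r.
Hypothesis ncJ : ~ countable [set: J].
Hypothesis sigmaK : forall x, free_lift p (sigma x) = x.

(** With [s] the support of [sigma x], the point [k] dominates all generators occurring in [x] at
    every large level. Any two bounds become comparable, so the larger can be kept. *)
Lemma ladder_top (s : seq J) :
  exists k N, forall n, (N <= n)%N -> forall i, i \in s -> r n i k.
Proof.
elim: s => [|j s [k [N kP]]].
  have [k _] : [set: J] !=set0.
    by apply/set0P/negP => /eqP J0; apply: ncJ; rewrite J0.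
  by exists k, 0%N.
have [m [jk|kj]] := ladder_total rP (x := j) (y := k) I I.
  exists k, (maxn N m) => n; rewrite geq_max => /andP[Nn mn] i.
  rewrite inE => /orP[/eqP->|]; last exact: kP.
  exact: (ladder_mono rP mn jk).
exists j, (maxn N m) => n; rewrite geq_max => /andP[Nn mn] i.
rewrite inE => /orP[/eqP->|is_]; first exact: (ladder_refl rP).
exact: (ladder_trans rP (kP _ Nn _ is_) (ladder_mono rP mn kj)).
Qed.

Lemma local_factor (X0 : seq P) : exists X1 : seq P,
  forall y : {linear P -> R^o}, (forall x, x \in X1 -> y (f x) = 0) ->
  exists z : {linear P -> R^o}, forall x, x \in X0 -> y x = z (f x).
Proof.
apply: contrapT => /forallNP noX1.
have /choice[ym ymP] : forall X1 : seq P, exists y : {linear P -> R^o},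
    (forall x, x \in X1 -> y (f x) = 0) /\
    ~ exists z : {linear P -> R^o}, forall x, x \in X0 -> y x = z (f x).
  move=> X1; have /existsNP[y /not_implyP[y1 y2]] := noX1 X1.
  by exists y.
have /choice[dn dnP] : forall q : nat * J, exists s : seq J,
    forall i, r q.1 i q.2 -> i \in s.
  move=> [n a]; have /finite_seqP[s sE] := ladder_fin rP n a.
  by exists s => i ia; have : [set x | r n x a] i by []; rewrite sE.
(* The finite set defeated by [y n a] consists of the generators below [a] at level n. *)
pose y n a := ym (map p (dn (n, a))).
have yr n a i : r n i a -> y n a (f (p i)) = 0.
  by move=> ia; apply: (ymP _).1; apply: map_f; apply: dnP.
have yN n a := (ymP (map p (dn (n, a)))).2.
(* Only the generators above [a] at level n are kept. Each has finitely many points below it, so for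
   fixed n the family of the [g n a] is pointwise finite in [a]. *)
pose c n a i : R^o := if `[< r n a i >] then y n a (f (p i)) else 0.
pose g n a : {linear P -> R^o} := free_lift (c n a) \o sigma.
have gE n a x : g n a x = free_lift (c n a) (sigma x) by [].
have yE n a x : y n a (f x) = free_lift (fun i => y n a (f (p i))) (sigma x).
  by rewrite -{1}(sigmaK x) -[y n a (f _)]/((y n a \o f) _) linear_free_lift.
(* If [a] is below [k] at level [n], then the indices [i] below [k] are above
   [a], where [c] keeps them, or below [a], where [y n a (f (p i))] is 0. *)
have gP x : exists k N, forall n a, (N <= n)%N ->
    g n a x = (if `[< r n a k >] then y n a (f x) else 0) /\
    (r n k a -> y n a (f x) = 0).
  have [s us sP] := free_support (sigma x).
  have xs i : i \notin s -> sigma x i = 0 by rewrite sP negbK => /eqP.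
  have [k [N kP]] := ladder_top s.
  exists k, N => n a Nn; rewrite gE yE !(free_liftE _ us xs).
  have {}kP := kP n Nn.
  split; last first.
    move=> ka; apply: big1_seq => i /andP[_ /kP ik].
    by rewrite yr ?scaler0 //; apply: (ladder_trans rP ik ka).
  case: asboolP => ak; last first.
    apply: big1_seq => i /andP[_ /kP ik]; rewrite /c.
    by case: asboolP => [ai|_]; [case: ak; apply: (ladder_trans rP ai ik)
                                |rewrite scaler0].
  apply: eq_big_seq => i /kP ik; rewrite /c; case: asboolP => // ai.
  by have [|ia] := ladder_tree rP ak ik; [|rewrite yr].
(* The list [s] does not depend on the level, so finitely many levels can be bounded together. *)
have gF n x : finite_set [set a | g n a x <> 0] /\
   exists s : seq J, forall m a, g m a x <> 0 -> exists2 i, i \in s & r m a i.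
  have [s us sP] := free_support (sigma x).
  have xs i : i \notin s -> sigma x i = 0 by rewrite sP negbK => /eqP.
  have gs m a : g m a x <> 0 -> exists2 i, i \in s & r m a i.
    rewrite gE (free_liftE _ us xs) => gn0; apply: contrapT => ns; apply: gn0.
    apply: big1_seq => i /andP[_ is_]; rewrite /c; case: asboolP => [ai|_].
      by case: ns; exists i.
    by rewrite scaler0.
  split; last by exists s.
  apply: (@sub_finite_set _ _ (\bigcup_(i in [set` s]) [set a | r n a i])).
    by move=> a /gs[i is_ ai]; exists i.
  by apply: bigcup_finite => // i _; apply: (ladder_fin rP).
(* By [gP] at [f x] and [ff0], [g n a (f x)] is 0 for all [a] once n is large, so the doubly indexed
   family is pointwise finite. Hence [g n a - h (n, a)] kills the image of f, while [h (n, a) x]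
   vanishes for large n, uniformly in [a]. *)
have [||h [hF hE]] := @factor_family (nat * J)%type
    (fun q => g q.1 q.2 \o f : {linear P -> R^o}).
- move=> x; have [k [N kP]] := gP (f x); have [_ [s sP]] := gF 0%N (f x).
  apply: (@sub_finite_set _ _
     (`I_N `*` \bigcup_(i in [set` s]) [set a | r N a i])).
    move=> [n a] /= gn0; have nN : (n < N)%N.
      rewrite ltnNge; apply/negP => Nn; apply: gn0.
      by rewrite -[LHS]/(g n a (f x)) (kP _ a Nn).1 ff0 linear0 if_same.
    have [i is_ ai] := sP _ _ gn0; split=> //; exists i => //=.
    exact: (ladder_mono rP (ltnW nN) ai).
  by apply: finite_setX => //; apply: bigcup_finite => // i _; apply: (ladder_fin rP).
- by move=> q x /=; rewrite ff0 linear0 (free_liftE (s := [::])) ?big_nil.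
(* Here the level is fixed, and finiteness is needed in [a] alone. *)
have /choice[t tP] : forall n, exists t : J -> {linear P -> R^o},
    (forall x, finite_set [set a | t a x <> 0]) /\
    forall a x, t a (f x) = g n a x - h (n, a) x.
  move=> n.
  have [||t [tF tE]] := @factor_family J
    (fun a => g n a \- h (n, a) : {linear P -> R^o}).
  - move=> x; apply: (@sub_finite_set _ _
      ([set a | g n a x <> 0] `|` (snd @` [set q | h q x <> 0]))).
      move=> a /= gha; have [ga|ga] := pselect (g n a x = 0); last by left.
      right; exists (n, a) => //= ha; apply: gha.
      by rewrite -[LHS]/(g n a x - h (n, a) x) ga ha subrr.
    by rewrite finite_setU; split; [case: (gF n x)|apply: finite_image].
  - by move=> a x /=; rewrite hE /= subrr.
  by exists t; split=> // a x; rewrite tE.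
(* For each n and each x in [X0] only finitely many [a] are excluded, hence countably many in all,
   and J is uncountable. *)
have [a aP] : exists a, forall n x, x \in X0 -> t n a x = 0.
  apply: contrapT => /forallNP noa; apply: ncJ.
  apply: (@sub_countable _ _ _
     (\bigcup_n \bigcup_(x in [set` X0]) [set a | t n a x <> 0])).
    apply: subset_card_le => a _; have /existsNP[n /existsNP[x]] := noa a.
    by move=> /not_implyP[xX tx]; exists n => //; exists x.
  apply: bigcup_countable => // n _; apply: bigcup_countable => [|x _].
    exact: finite_set_countable.
  by apply: finite_set_countable; case: (tP n).
(* With [a] fixed, [k n (f x)] equals [y n a (f x) - g n a x + h (n, a) x], which is 0 for large n;
   so the argument for a sequence applies to the [k n]. *)
pose k n : {linear P -> R^o} := y n a \- t n a.
have [||l [lF lE]] := @factor_family nat (fun n => k n \o f : {linear P -> R^o}).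
- move=> x; have [j [N jP]] := gP x.
  have [N2 N2P] := finite_set_nat_bounded (finite_image fst (hF x)).
  have [m am] := ladder_total rP (x := a) (y := j) I I.
  apply: (@sub_finite_set _ _ `I_(maxn N (maxn N2 m))) => // n /= kn0.
  rewrite ltnNge !geq_max; apply/negP => /and3P[Nn N2n mn]; apply: kn0.
  have h0 : h (n, a) x = 0.
    apply: contrapT => hn0; have /N2P : (fst @` [set q | h q x <> 0]) n.
      by exists (n, a).
    by rewrite ltnNge N2n.
  have [gy y0] := jP n a Nn; have [_ tE] := tP n.
  rewrite -[LHS]/(y n a (f x) - t n a (f x)) tE h0 subr0 gy.
  case: asboolP => [_|naj]; first by rewrite subrr.
  rewrite subr0; apply: y0; case: am => [aj|ja]; last exact: (ladder_mono rP mn ja).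
  by case: naj; apply: (ladder_mono rP mn aj).
- by move=> n x; rewrite -[LHS]/(k n (f (f x))) ff0 linear0.
have [N NP] : exists N, forall n, (\bigcup_(x in [set` X0]) [set n | l n x <> 0]) n ->
    (n < N)%N.
  by apply: finite_set_nat_bounded; apply: bigcup_finite => // x _; apply: lF.
(* On [X0] both [t N a] and [l N] vanish, so [y N a] agrees there with [k N - l N], which kills the
   image of f and thus factors through f. *)
apply: (yN N a).
have [|z zE] := factor (@regular_projective R)
    (u := k N \- l N : {linear P -> R^o}).
  by move=> x /=; rewrite lE /= subrr.
exists z => x xX; rewrite zE /= aP // subr0.
have -> : l N x = 0.
  apply: contrapT => lx; have /NP : (\bigcup_(x in [set` X0]) [set n | l n x <> 0]) N.
    by exists x.
  by rewrite ltnn.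
by rewrite subr0.
Qed.

End LocalFactorization.

(** * Sums in tensor products and evaluation at a functional *)

Lemma morphB_sum (U V : zmodType) (h : U -> V) : {morph h : x y / x - y} ->
  forall (I : Type) (s : seq I) (F : I -> U),
  h (\sum_(i <- s) F i) = \sum_(i <- s) h (F i).
Proof.
move=> hB I s F; pose h' : {additive U -> V} :=
  HB.pack h (GRing.isZmodMorphism.Build U V h hB).
exact: (raddf_sum h').
Qed.

Section PureSums.
Context (R : pzRingType) (E : lmodType R^c) (M : lmodType R).

Lemma pureBr (e : E) (x y : M) : pure e (x - y) = pure e x - pure e y.
Proof.
have [_ pD _] := balanced_pure E M.
by apply/eqP; rewrite eq_sym subr_eq -pD subrK.
Qed.

Lemma pureBl (e1 e2 : E) (x : M) : pure (e1 - e2) x = pure e1 x - pure e2 x.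
Proof.
have [pD _ _] := balanced_pure E M.
by apply/eqP; rewrite eq_sym subr_eq -pD subrK.
Qed.

Lemma pureZ (a : R) (e : E) (x : M) : pure e (a *: x) = pure ((a : R^c) *: e) x.
Proof. by have [_ _ ->] := balanced_pure E M. Qed.

Lemma pure0r (e : E) : pure e (0 : M) = 0.
Proof. by rewrite -(subrr (0 : M)) pureBr subrr. Qed.

Lemma pure0l (x : M) : pure (0 : E) x = 0.
Proof. by rewrite -(subrr (0 : E)) pureBl subrr. Qed.

Context (z : {linear M -> R^o}).

(** This is id (x) z followed by the identification of E (x) R with E. *)
Definition tensor_eval : tensor E M -> E :=
  tensor_lift (fun e x => (z x : R^c) *: e).

Fact tensor_eval_balanced : balanced (fun (e : E) (x : M) => (z x : R^c) *: e).
Proof.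
split=> [e1 e2 x|e x y|a e x]; first by rewrite scalerDr.
  by rewrite linearD -scalerDl.
by rewrite scalerA linearZ_LR.
Qed.

Lemma tensor_evalB : {morph tensor_eval : s t / s - t}.
Proof. exact/tensor_lift_additive/tensor_eval_balanced. Qed.

Lemma tensor_evalE e x : tensor_eval (pure e x) = (z x : R^c) *: e.
Proof. exact/tensor_liftE/tensor_eval_balanced. Qed.

Lemma tensor_eval0 : tensor_eval 0 = 0.
Proof. by rewrite -(subrr (0 : tensor E M)) tensor_evalB subrr. Qed.

End PureSums.

Section TensorMaps.
Context (R : pzRingType) (E E' E'' : lmodType R^c) (M M' M'' : lmodType R).
Context (f : {linear E -> E'}) (g : {linear M -> M'}).

Lemma tensor_map_comp0 (f' : {linear E' -> E''}) (g' : {linear M' -> M''}) :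
  (forall e x, pure (f' (f e)) (g' (g x)) = 0) ->
  forall t, tensor_map f' g' (tensor_map f g t) = 0.
Proof.
move=> fg0 t; elim/tensor_ind: t => [|t u IHt IHu|e x].
- by rewrite -(subrr (0 : tensor E M)) !tensor_mapB !subrr.
- by rewrite !tensor_mapB IHt IHu subrr.
- by rewrite !tensor_mapE fg0.
Qed.

Lemma tensor_eval_map (z : {linear M -> R^o}) t :
  tensor_eval z (tensor_map f (idfun : {linear M -> M}) t) = f (tensor_eval z t).
Proof.
elim/tensor_ind: t => [|t u IHt IHu|e x].
- by rewrite -(subrr (0 : tensor E M)) tensor_mapB !tensor_evalB !subrr linear0.
- by rewrite tensor_mapB !tensor_evalB linearB IHt IHu.
- by rewrite tensor_mapE !tensor_evalE linearZ_LR.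
Qed.

End TensorMaps.

(** * Dual bases and flatness *)

Section Coordinates.
Context (R : pzRingType) (P : lmodType R) (J : choiceType) (p : J -> P).
Context (sigma : {linear P -> free_module R J}).
Hypothesis sigmaK : forall x, free_lift p (sigma x) = x.

Fact dual_coord_linear j : linear (fun x => sigma x j : R^o).
Proof. by move=> a x y; rewrite linearP free_linE. Qed.

Definition dual_coord j : {linear P -> R^o} := linear_of (dual_coord_linear j).

Lemma dual_coord_expand x : exists s0 : seq J, forall s, uniq s ->
  {subset s0 <= s} -> x = \sum_(j <- s) (dual_coord j x : R) *: p j.
Proof.
have [s0 us0 s0P] := free_support (sigma x); exists s0 => s us s0s.
rewrite -{1}(sigmaK x) (free_liftE _ us) // => j js; apply/eqP.
by have := contraNN (s0s j) js; rewrite s0P negbK.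
Qed.

(** The dual basis formula, transported to the second factor. Allowing every list that contains [s0]
    lets different tensors share one list. *)
Lemma tensor_expand (E : lmodType R^c) (t : tensor E P) :
  exists s0 : seq J, forall s, uniq s -> {subset s0 <= s} ->
  t = \sum_(j <- s) pure (tensor_eval (dual_coord j) t) (p j).
Proof.
elim/tensor_ind: t => [|t u [s1 s1P] [s2 s2P]|e x].
- by exists [::] => s _ _; rewrite big1 // => j _; rewrite tensor_eval0 pure0l.
- exists (s1 ++ s2) => s us s12.
  rewrite {1}(s1P s us) => [|j j1]; last by apply: s12; rewrite mem_cat j1.
  rewrite {1}(s2P s us) => [|j j1]; last by apply: s12; rewrite mem_cat j1 orbT.
  by rewrite -sumrB; apply: eq_bigr => j _; rewrite tensor_evalB pureBl.
- have [s0 s0P] := dual_coord_expand x; exists s0 => s us s0s.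
  rewrite {1}(s0P s us s0s) (morphB_sum (@pureBr R E P e)).
  by apply: eq_bigr => j _; rewrite pureZ tensor_evalE.
Qed.

(** By naturality of [tensor_eval], the coordinates of a tensor killed by g are themselves killed by
    g. They lift along f one by one, and the lifts are reassembled along [p]. *)
Lemma dual_basis_flat : flat P.
Proof.
move=> A B C f g fg t; split=> [gt0|[u <-]]; last first.
  apply: tensor_map_comp0 => a x.
  by rewrite (_ : g (f a) = 0) ?pure0l //; apply/fg; exists a.
have [s0 s0P] := tensor_expand t.
have us0 := undup_uniq s0; have ss0 : {subset s0 <= undup s0}.
  by move=> j; rewrite mem_undup.
have /choice[a aP] : forall j, exists a, f a = tensor_eval (dual_coord j) t.
  by move=> j; apply/fg; rewrite -tensor_eval_map gt0 tensor_eval0.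
exists (\sum_(j <- undup s0) pure (a j) (p j)).
rewrite [RHS](s0P _ us0 ss0) (morphB_sum (tensor_mapB _ _)).
by apply: eq_bigr => j _; rewrite tensor_mapE aP.
Qed.

End Coordinates.

(** * Injective modules and linear systems *)

Section Image.
Context (S : pzRingType) (V W : lmodType S) (theta : {linear V -> W}).

Definition img_pred : {pred W} := [pred w | `[< exists v, theta v = w >]].

Fact img_submod_closed : submod_closed img_pred.
Proof.
split=> [|a u v]; rewrite !inE; first by exists 0; rewrite linear0.
by move=> [u' <-] [v' <-]; exists (a *: u' + v'); rewrite linearP.
Qed.

HB.instance Definition _ :=
  GRing.isSubmodClosed.Build S W img_pred
    (GRing.submod_closed_semi img_submod_closed).

Record img : Type := Img { img_val : W; _ : img_val \in img_pred }.

HB.instance Definition _ := [isSub for img_val].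
HB.instance Definition _ := [Choice of img by <:].
HB.instance Definition _ := [SubChoice_isSubLmodule of img by <:].

(** [eps] factors through the image of [theta], and injectivity extends it from there to [W]. *)
Lemma injective_extend (E : lmodType S) (eps : {linear V -> E}) :
  injective_module E -> (forall v, theta v = 0 -> eps v = 0) ->
  exists c : {linear W -> E}, forall v, c (theta v) = eps v.
Proof.
move=> Einj eps0.
have eps_eq u v : theta u = theta v -> eps u = eps v.
  move=> uv; apply/eqP; rewrite -subr_eq0 -linearB eps0 //.
  by rewrite linearB uv subrr.
have /choice[s sP] : forall w : img, exists v, theta v = val w.
  by move=> w; have := valP w; rewrite inE.
have lin : linear (fun w : img => eps (s w)).
  move=> a u v; rewrite -linearP; apply: eps_eq.
  by rewrite linearP !sP.
have linv : linear (val : img -> W) by [].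
have [c cP] := Einj img W (linear_of linv) (linear_of lin) val_inj.
exists c => v; have tv : theta v \in img_pred by rewrite inE; exists v.
by have := cP (Img tv); rewrite /= => ->; apply: eps_eq; rewrite sP.
Qed.

End Image.

(** A finite system over an injective module is solvable once it respects the relations between its
    rows: the map given by [eps] extends along multiplication by [A], and its values on the standard
    basis are a solution. Entries lie in [R^c] because E is a right module. *)
Lemma injective_solve (R : pzRingType) (E : lmodType R^c) (n m : nat)
    (A : 'M[R^c]_(n, m)) (eps : 'I_n -> E) : injective_module E ->
  (forall r : 'rV[R^c]_n, r *m A = 0 -> \sum_i r 0 i *: eps i = 0) ->
  exists c : 'I_m -> E, forall i, \sum_k A i k *: c k = eps i.
Proof.
move=> Einj Aeps.
have lin : linear (fun r : 'rV[R^c]_n => \sum_i r 0 i *: eps i).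
  move=> a u v; rewrite scaler_sumr -big_split; apply: eq_bigr => i _.
  by rewrite !mxE scalerDl scalerA.
have [c cP] := injective_extend (theta := mulmxr A) (eps := linear_of lin) Einj Aeps.
exists (fun k => c (delta_mx 0 k)) => i.
have := cP (delta_mx 0 i); rewrite /= -rowE.
rewrite [row i A]row_sum_delta linear_sum (bigD1 i) //= mxE !eqxx scale1r.
rewrite [X in _ + X]big1 ?addr0 => [<-|j ij]; last first.
  by rewrite mxE (negPf ij) andbF scale0r.
by apply: eq_bigr => k _; rewrite linearZ_LR mxE.
Qed.

(** * Exactness after tensoring with an injective module *)

Section TensorExact.
Context (R : pzRingType) (P : lmodType R) (f : {linear P -> P}).
Hypothesis ff0 : forall x, f (f x) = 0.
Hypothesis locally_factors : forall X0 : seq P, exists X1 : seq P,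
  forall y : {linear P -> R^o}, (forall x, x \in X1 -> y (f x) = 0) ->
  exists z : {linear P -> R^o}, forall x, x \in X0 -> y x = z (f x).
Context (J : choiceType) (p : J -> P) (sigma : {linear P -> free_module R J}).
Hypothesis sigmaK : forall x, free_lift p (sigma x) = x.

(** A preimage of t is sought as a sum of [c k] (x) x_k over [X1]; comparing coordinates gives a
    linear system for [c]. A relation r between its rows is a functional y with y f = 0 on [X1], so
    y is z f on the generators used by t, and r applied to the right-hand sides is z evaluated at
    the image of t, which is 0. *)
Lemma injective_tensor_exact (E : lmodType R^c) : injective_module E ->
  exact_at (tensor_map (idfun : {linear E -> E}) f)
           (tensor_map (idfun : {linear E -> E}) f).
Proof.
move=> Einj t; split=> [ft0|[u <-]]; last first.
  by apply: tensor_map_comp0 => e x; rewrite ff0 pure0r.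
have [s0 s0P] := tensor_expand sigmaK t.
have [X1 X1P] := locally_factors (map p (undup s0)).
have /choice[sx sxP] := dual_coord_expand sigmaK.
(* Both t and every [f x] with x in [X1] must expand along [s]. *)
pose s := undup (s0 ++ flatten [seq sx (f x) | x <- X1]).
have us : uniq s by exact: undup_uniq.
have s0s : {subset s0 <= s} by move=> j js; rewrite mem_undup mem_cat js.
have sxs x : x \in X1 -> {subset sx (f x) <= s}.
  move=> xX j js; rewrite mem_undup mem_cat; apply/orP; right.
  by apply/flattenP; exists (sx (f x)) => //; apply/mapP; exists x.
pose phi := dual_coord sigma.
pose A : 'M[R^c]_(size s, size X1) := \matrix_(i, k)
  phi (tnth (in_tuple s) i) (f (tnth (in_tuple X1) k)).
pose eps (i : 'I_(size s)) := tensor_eval (phi (tnth (in_tuple s) i)) t.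
have [r rA|c cP] := @injective_solve R E _ _ A eps Einj.
  have liny : linear (fun x : P =>
      \sum_i ((phi (tnth (in_tuple s) i) x : R) * (r 0 i : R)) : R^o).
    move=> a x y; rewrite scaler_sumr -big_split; apply: eq_bigr => i _.
    by rewrite linearP mulrDl /= -mulrA.
  have [x xX|z zP] := X1P (linear_of liny).
    have [k kX] : exists k, tnth (in_tuple X1) k = x.
      by have /tnthP[k ->] : x \in in_tuple X1 by []; exists k.
    have := congr1 (fun B : 'rV_(size X1) => B 0 k) rA; rewrite !mxE => rA0.
    by rewrite -[RHS]rA0 -kX; apply: eq_bigr => i _; rewrite mxE.
  (* [X1] was chosen for the generators in [s0] only, so t is expanded along [s0] here and not along
     [s]. *)
  have us0 := undup_uniq s0; have ss0 : {subset s0 <= undup s0}.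
    by move=> j; rewrite mem_undup.
  pose e j := tensor_eval (phi j) t.
  have tE : t = \sum_(j <- undup s0) pure (e j) (p j) := s0P _ us0 ss0.
  transitivity (tensor_eval z (tensor_map (idfun : {linear E -> E}) f t)); last first.
    by rewrite ft0 tensor_eval0.
  rewrite [in RHS]tE (morphB_sum (tensor_mapB _ _)) (morphB_sum (tensor_evalB _)).
  (* P need not be free, so the functionals [phi i] need not be dual to the [p j]; each [eps i] is
     therefore expanded as well. *)
  transitivity (\sum_i \sum_(j <- undup s0)
      (r 0 i * (phi (tnth (in_tuple s) i) (p j) : R^c)) *: e j).
    apply: eq_bigr => i _; rewrite /eps [in LHS]tE (morphB_sum (tensor_evalB _)).
    by rewrite scaler_sumr; apply: eq_bigr => j _; rewrite tensor_evalE scalerA.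
  rewrite exchange_big; apply: eq_big_seq => j js.
  by rewrite tensor_mapE tensor_evalE -zP ?map_f // -scaler_suml.
exists (\sum_k pure (c k) (tnth (in_tuple X1) k)).
rewrite (morphB_sum (tensor_mapB _ _)) [RHS](s0P s us s0s) [RHS]big_tnth.
transitivity (\sum_k \sum_i
    pure (A i k *: c k) (p (tnth (in_tuple s) i))).
  apply: eq_bigr => k _; rewrite tensor_mapE.
  have kX : tnth (in_tuple X1) k \in X1 by exact: (mem_tnth k (in_tuple X1)).
  rewrite {1}(sxP _ s us (sxs _ kX)).
  rewrite (morphB_sum (@pureBr R E P _)) [LHS]big_tnth; apply: eq_bigr => i _.
  by rewrite pureZ mxE.
rewrite exchange_big; apply: eq_bigr => i _.
rewrite -/(eps i) -cP (morphB_sum (fun e1 e2 => @pureBl R E P e1 e2 _)).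
by [].
Qed.

End TensorExact.

(** * Generators indexed by a ladder, and the conclusion *)

Lemma projective_dual_basis (R : pzRingType) (P : lmodType R) (J : choiceType)
    (p : J -> P) : projective P ->
  (forall x, exists y : free_module R J, free_lift p y = x) ->
  exists sigma : {linear P -> free_module R J},
    forall x, free_lift p (sigma x) = x.
Proof.
by move=> Pproj psurj; apply: (Pproj _ _ (free_lift p) (idfun : {linear P -> P})).
Qed.

(** Points of one fibre lie below each other at every level, which is why ladders are preorders and
    not orders; finite fibres keep initial segments finite. *)
Lemma ladder_pullback (T J : Type) (h : J -> T) (D : set T) r :
  (forall j, D (h j)) -> (forall x, finite_set [set j | h j = x]) ->
  ladder_on D r -> ladder_on [set: J] (fun n i j => r n (h i) (h j)).
Proof.
move=> hD hF rP; split=> //.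
- by move=> n x _; apply: (ladder_refl rP).
- by move=> n x y z; apply: (ladder_trans rP).
- by move=> m n x y; apply: (ladder_mono rP).
- move=> n y; apply: (@sub_finite_set _ _
      (\bigcup_(x in [set x | r n x (h y)]) [set j | h j = x])).
    by move=> x xy; exists (h x).
  by apply: bigcup_finite => [|x _]; [apply: (ladder_fin rP)|apply: hF].
- by move=> x y _ _; apply: (ladder_total rP).
- by move=> n x y z; apply: (ladder_tree rP).
Qed.

Section GeneratingFamily.
Context (R : pzRingType) (P M : lmodType R) (f : {linear P -> P}).
Hypothesis fexact : exact_at f f.
Context (h : {linear M -> ker f}).
Hypothesis hbij : bijective h.

Let kval : {linear ker f -> P} :=
  linear_of (g := fun k : ker f => ker_val k) (fun a k l => erefl).

Lemma ker_generators (D : Type) (q : D -> M) : generates (range q) ->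
  exists p : {classic (D * bool)} -> P,
  forall x, exists y : free_module R {classic (D * bool)}, free_lift p y = x.
Proof.
move=> qgen.
have /choice[b bP] : forall d, exists x, f x = kval (h (q d)).
  move=> d; apply/fexact; have := valP (h (q d)); rewrite inE => /eqP.
  exact.
pose p (z : {classic (D * bool)}) := if z.2 then kval (h (q z.1)) else b z.1.
exists p.
pose S x := exists y : free_module R {classic (D * bool)}, free_lift p y = x.
have SD x y : S x -> S y -> S (x + y).
  by move=> [x' <-] [y' <-]; exists (x' + y'); rewrite linearD.
have Sp (n : nat) (a : 'I_n -> R) (z : 'I_n -> D * bool) :
    S (\sum_i a i *: p (z i)).
  exists (\sum_i a i *: free_delta R (z i : {classic (D * bool)})).
  rewrite linear_sum; apply: eq_bigr => i _.
  by rewrite linearZ_LR /= free_lift_delta.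
have Sk (k : ker f) : exists (n : nat) (a : 'I_n -> R) (d : 'I_n -> D),
    kval k = \sum_i a i *: kval (h (q (d i))).
  have [h' _ h'K] := hbij.
  have [n [a [g [gq gE]]]] := qgen (h' k).
  have /choice[d dP] : forall i, exists d, q d = g i.
    by move=> i; have [d _ <-] := gq i; exists d.
  exists n, a, d; rewrite -[in LHS](h'K k) gE !linear_sum.
  by apply: eq_bigr => i _; rewrite !linearZ_LR dP.
have Sker x : f x = 0 -> S x.
  move=> fx; have kx : x \in ker_pred f by rewrite inE fx.
  have [n [a [d xE]]] := Sk (Ker kx).
  rewrite -[x]/(kval (Ker kx)) xE.
  exact: (Sp n a (fun i => (d i, true))).
move=> x; have fx0 : f (f x) = 0 by apply/fexact; exists x.
have kfx : f x \in ker_pred f by rewrite inE fx0.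
have [n [a [d fxE]]] := Sk (Ker kfx).
rewrite -[x](subrK (\sum_i a i *: b (d i))); apply: SD.
  apply: Sker; rewrite linearB -[f x]/(kval (Ker kfx)) fxE linear_sum.
  apply/eqP; rewrite subr_eq0; apply/eqP.
  by apply: eq_bigr => i _; rewrite linearZ_LR bP.
exact: (Sp n a (fun i => (d i, false))).
Qed.

End GeneratingFamily.

(** The ladder lives on some uncountable subset of T; as aleph_1 is the least uncountable cardinal,
    this subset is large enough to index the generators. *)
Lemma aleph1_ladder_generators (R : pzRingType) (M : lmodType R) :
  aleph1_generated M ->
  exists (D : Type) (r : nat -> D -> D -> Prop) (q : D -> M),
  [/\ ladder_on [set: D] r, ~ countable [set: D] & generates (range q)].
Proof.
move=> [T [A [G [[ncA leA] GA Ggen]]]].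
have ncT : ~ countable [set: T].
  by move=> cT; apply: ncA; apply: sub_countable cT; apply: subset_card_le.
have [D [r [rP ncD]]] := uncountable_ladder ncT.
have /card_leP[i] := card_le_trans GA (leA _ _ ncD).
(* Indices that match no generator are sent to 0, so the index set stays uncountable even if M has
   few generators. *)
have /choice[q qP] : forall d : D, exists m : M, forall g : G, i g = d -> val g = m.
  move=> d; have [[g gd]|nd] := pselect (exists g, i g = d); last first.
    by exists 0 => g gd; case: nd; exists g.
  exists (val g) => g'; rewrite -gd => ig.
  by congr val; apply: (@inj _ _ _ i); rewrite ?inE.
exists D, (fun n x y => r n (val x) (val y)), q; split.
- apply: ladder_pullback rP => [x|x]; first by have := valP x; rewrite inE.
  have [xD|nDx] := pselect (x \in D).
    apply: sub_finite_set (finite_set1 (exist _ x xD : D)) => y /= yx.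
    exact/val_inj.
  rewrite (_ : [set _ | _] = set0) //; apply/seteqP; split=> // y /= yx.
  by apply: nDx; rewrite -yx; apply: valP.
- move=> cD; apply: ncD; apply: sub_countable cD.
  apply: card_le_trans (card_image_le (val : D -> T) _).
  apply: subset_card_le => x Dx; have xD : x \in D by rewrite inE.
  by exists (exist _ x xD : D).
- move=> x; have [n [a [g [gG ->]]]] := Ggen x; exists n, a, g; split=> // j.
  have gj : g j \in G by rewrite inE; apply: gG.
  exists (i (exist _ (g j) gj)) => //.
  by rewrite -(qP _ (exist _ (g j) gj) erefl).
Qed.

Theorem proposition2p1 (R : pzRingType) (M : lmodType R)
    (hgen : aleph1_generated M) (hM : strongly_Gorenstein_projective M) :
  Gorenstein_flat M.
Proof.
have [P [f [[Pproj fex fhom] [h hbij]]]] := hM.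
have {}Pproj : projective P := Pproj 0.
have {}fex : exact_at f f := fex 0.
have ff0 x : f (f x) = 0 by apply/fex; exists x.
have factor (Q : lmodType R) : projective Q ->
    forall u : {linear P -> Q}, (forall x, u (f x) = 0) ->
    exists v : {linear P -> Q}, forall x, v (f x) = u x.
  by move=> Qproj u /(fhom Q Qproj 0 u).
have [D [r [q [rP ncD qgen]]]] := aleph1_ladder_generators hgen.
have [p psurj] := ker_generators fex hbij qgen.
have [sigma sigmaK] := projective_dual_basis Pproj psurj.
have r'P : ladder_on [set: {classic (D * bool)}] (fun n x y => r n x.1 y.1).
  apply: (ladder_pullback (h := fst) (D := [set: D])) rP => // d.
  apply: (@sub_finite_set _ _ [set (d, true); (d, false)]) => [[e b] /= ->|].
    by case: b; [left|right].
  exact: finite_set2.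
have ncJ : ~ countable [set: {classic (D * bool)}].
  move=> cJ; apply: ncD; apply: sub_countable cJ.
  apply: card_le_trans (card_image_le (fst : D * bool -> D) _).
  by apply: subset_card_le => d _; exists (d, true).
(* The given complete projective resolution is itself a complete flat resolution. *)
exists (fun=> P), (fun=> f); split; last by exists h.
split=> [_|_|E Einj _]; first exact: (dual_basis_flat sigmaK).
  exact: fex.
exact: (injective_tensor_exact ff0 (local_factor ff0 factor r'P ncJ sigmaK) sigmaK).
Qed.
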